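(* Let $\mu$ and $\nu$ be two finite positive Borel measures on $\mathbb{C}$, each with compact and infinite support, and let $q\in\mathbb{N}_0$ be fixed. Then $$\lim_{n\to\infty}\left(\frac{P_{n-1}(z;\mu)}{P_{n}(z;\mu)}-\frac{P_{n-q-1}(z;\nu)}{P_{n-q}(z;\nu)}\right)=0\qquad\text{for all } |z|>\max\{R_\mu,R_\nu\}$$ if and only if for every $j\in\mathbb{N}_0$ it holds that $$\lim_{n\to\infty}\left(h_{j,n}(\mu)-h_{j,n-q}(\nu)\right)=0.$$
   Context: $\mathbb{N}_0=\mathbb{N}\cup\{0\}$. For a finite positive measure $\mu$ on $\mathbb{C}$ with compact and infinite support, $\{p_n(z;\mu)\}_{n\ge0}$ denotes the sequence of orthonormal polynomials: $p_n(\cdot;\mu)$ has degree $n$, positive leading coefficient $\kappa_n(\mu)>0$, and $\int p_n\overline{p_m}\,d\mu=\delta_{m,n}$. The monic orthogonal polynomial is $P_n(z;\mu)=\kappa_n(\mu)^{-1}p_n(z;\mu)$. Set $R_\mu=\sup\{|z|:z\in\mathrm{supp}(\mu)\}$. The Bergman Shift matrix $M_\mu$ is the matrix of multiplication by $z$ on the closure of the polynomials in $L^2(\mu)$ in the orthonormal basis $\{p_n\}_{n\ge0}$; its rows and columns are indexed by $\{1,2,3,\ldots\}$, with $(M_\mu)_{i,k}=\int z\,p_{k-1}(z;\mu)\overline{p_{i-1}(z;\mu)}\,d\mu(z)$, so that $(M_\mu)_{i,k}=0$ for $i>k+1$. For $j\in\mathbb{N}_0$ and $n>j$, $$h_{j,n}(\mu):=\frac{\kappa_{n-1-j}(\mu)}{\kappa_{n-1}(\mu)}(M_{\mu})_{n-j,n}.$$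 Limits as $n\to\infty$ concern only $n$ large enough that all quantities are defined. *)

(* Defs.v *)
From HB Require Import structures.
From mathcomp Require Import all_boot all_order all_algebra.
From mathcomp Require Import all_classical all_reals all_analysis.
From mathcomp Require Import complex.
Set Implicit Arguments.
Unset Strict Implicit.
Unset Printing Implicit Defensive.
Import Order.TTheory GRing.Theory Num.Theory.
Import numFieldNormedType.Exports.
Local Open Scope classical_set_scope.
Local Open Scope ring_scope.

(* [R[i]^o] rather than [R[i]]: only the former carries the norm topology,
   whose balls have radii in [R[i]] that are positive, hence real. *)
Definition Borel_complex (R : realType) :=
  g_sigma_algebraType (@open (R[i]^o)).

Section Measures.
Context {R : realType}.
Implicit Type mu : {finite_measure set (Borel_complex R) -> \bar R}.

Definition supp mu : set (R[i]^o) :=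
  [set z | forall U : set (R[i]^o), open U -> U z -> (0 < mu U)%E].

Definition supp_radius mu : R := sup [set complex.Re `|z| | z in supp mu].

Definition Cintegral mu (f : R[i] -> R[i]) : R[i] :=
  Complex (Rintegral mu setT (fun z => complex.Re (f z)))
          (Rintegral mu setT (fun z => complex.Im (f z))).

(* In [R[i]], [0 < c] means that [c] is real and positive. *)
Definition orthonormal_polys mu (p : nat -> {poly R[i]}) : Prop :=
  [/\ forall n, size (p n) = n.+1,
      forall n, 0 < lead_coef (p n) &
      forall n m,
        Cintegral mu (fun z => (p n).[z] * ((p m).[z])^*) = (m == n)%:R].

Definition monic_poly (p : nat -> {poly R[i]}) (n : nat) : {poly R[i]} :=
  (lead_coef (p n))^-1 *: p n.

(* Rows and columns are indexed from 1; the values at index 0 are junk. *)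
Definition bergman_shift mu (p : nat -> {poly R[i]}) (i k : nat) : R[i] :=
  Cintegral mu (fun z => z * (p k.-1).[z] * ((p i.-1).[z])^*).

(* Meaningful for [j < n]; the natural-number subtractions truncate otherwise. *)
Definition shift_coef mu (p : nat -> {poly R[i]}) (j n : nat) : R[i] :=
  lead_coef (p (n - 1 - j)%N) / lead_coef (p (n - 1)%N)
  * bergman_shift mu p (n - j) n.

End Measures.

(* Main.v *)
Require Import Defs.
From HB Require Import structures.
From mathcomp Require Import all_boot all_order all_algebra.
From mathcomp Require Import all_classical all_reals all_analysis.
From mathcomp Require Import measurable_realfun complex.
From mathcomp Require Import zify ring lra.
Set Implicit Arguments.
Unset Strict Implicit.
Unset Printing Implicit Defensive.
Import Order.TTheory GRing.Theory Num.Theory.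
Import numFieldNormedType.Exports.
Local Open Scope classical_set_scope.
Local Open Scope ring_scope.

(** Put [N = n - 1] and let [T] be multiplication by [z] compressed to the
    polynomials of degree at most [N]: multiply by [z], then subtract the
    component along [p (N + 1)].  Its matrix in the orthonormal basis is the
    upper left corner of the Bergman shift matrix, its norm is at most the
    radius of the support, and its resolvent is explicit ([cshift_resolvent]).
    Hence the ratio [P_N / P_(N+1)] of monic polynomials is the corner entry
    of the resolvent of [T], and outside the disc it is a Laurent series
    [\sum_k a_(N,k) z^(-k-1)] with [a_(N,k)] the corner entry of [T^k] and
    with a geometric tail that is uniform in [N] ([ratio_expansion]).

    The uniform tail makes complex function theory unnecessary.  If all
    differences of Laurent coefficients tend to 0, the series may be truncated
    uniformly and the differences of ratios tend to 0 at every point outside the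
    disc.  Conversely, pointwise convergence at points of large modulus recovers
    the coefficients one after the other: after multiplication by [z^(k+1)]
    and removal of the earlier terms, the error in the [k]-th coefficient is
    [O(1/|z|)].  This is [vanishing_laurent].

    It remains to compare Laurent coefficients with the numbers [h_(j,n)].  Let
    [c_(N,k,i)] be the coefficient of the monic polynomial [P_(N-i)] in
    [T^k P_N] ([power_coef]).  Then [c_(N,k,0) = a_(N,k)], while
    [c_(N,1,j) = h_(j,N+1)], and the recurrence
    [z P_m = P_(m+1) + \sum_j h_(j,m+1) P_(m-j)] gives
    [c_(N,k+1,i) = c_(N,k,i+1) + \sum_(l <= i) c_(N,k,l) h_(i-l,N-l+1)]
    ([power_coef_rec]).  So [a_(N,k+1)] is [h_(k,N+1)] plus a polynomial,
    the same for all measures, in bounded quantities [h_(j,m)] with [j < k];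
    each of the two families of differences tends to 0 if and only if the
    other does ([vanishing_power_coefs]). *)

(** * The modulus and the topology of the complex plane *)

(** The norm of [R[i]] takes its values in [R[i]], whose order is only partial;
    [cabs] moves it to [R], where estimates and limits are taken. *)
Definition cabs {R : realType} (z : R[i]) : R := complex.Re `|z|.

Lemma continuous_horner_numField (K : numFieldType) (f : {poly K}) :
  continuous (fun z : K^o => f.[z] : K^o).
Proof.
elim/poly_ind: f => [|f c IH] z.
  have -> : (fun z : K^o => 0.[z] : K^o) = cst 0.
    by apply/funext => w; rewrite horner0.
  exact: cst_continuous.
have -> : (fun z : K^o => (f * 'X + c%:P).[z] : K^o) = (fun z => f.[z] * z + c).
  by apply/funext => w; rewrite hornerMXaddC.
suff H : (fun w : K^o => f.[w] * w + c : K^o) x @[x --> nbhs (z : K^o)] -->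
    (f.[z] * z + c : K^o).
  exact: H.
apply: (@cvgD K K^o); last exact: cvg_cst.
by apply: (@cvgM K); [exact: IH|exact: cvg_id].
Qed.

Section ComplexTopology.
Context {R : realType}.
Implicit Types z w : R[i].

Lemma cabsE z : `|z| = real_complex R (cabs z).
Proof. by rewrite /cabs RRe_real ?normr_real. Qed.

Lemma cabs_ge0 z : 0 <= cabs z.
Proof. by rewrite -ler0c -cabsE. Qed.

Lemma cabs0 : cabs (0 : R[i]) = 0.
Proof. by rewrite /cabs normr0. Qed.

Lemma cabsM z w : cabs (z * w) = cabs z * cabs w.
Proof. by apply: complexI; rewrite rmorphM -!cabsE normrM. Qed.

Lemma cabsN z : cabs (- z) = cabs z.
Proof. by rewrite /cabs normrN. Qed.

Lemma cabsX z n : cabs (z ^+ n) = cabs z ^+ n.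
Proof. by apply: complexI; rewrite rmorphXn -!cabsE normrX. Qed.

Lemma cabsD z w : cabs (z + w) <= cabs z + cabs w.
Proof. by rewrite -lecR rmorphD -!cabsE ler_normD. Qed.

Lemma cabsB_sym z w : cabs (z - w) = cabs (w - z).
Proof. by rewrite -cabsN opprB. Qed.

Lemma cabs_le z (a : R) : (`|z| <= real_complex R a) = (cabs z <= a).
Proof. by rewrite cabsE lecR. Qed.

Lemma cabs_conj z : cabs z^* = cabs z.
Proof. by rewrite /cabs norm_conjC. Qed.

Lemma cabs_real (a : R) : cabs (real_complex R a) = `|a|.
Proof. by rewrite /cabs normc_def /= expr0n addr0 sqrtr_sqr. Qed.

Lemma normr_Re_le z : `|complex.Re z| <= cabs z.
Proof. by rewrite /cabs normc_def /= -sqrtr_sqr ler_wsqrtr // lerDl sqr_ge0. Qed.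

Lemma normr_Im_le z : `|complex.Im z| <= cabs z.
Proof. by rewrite /cabs normc_def /= -sqrtr_sqr ler_wsqrtr // lerDr sqr_ge0. Qed.

Lemma cabs_le_ReIm z : cabs z <= `|complex.Re z| + `|complex.Im z|.
Proof.
rewrite {1}[z]complexE (le_trans (cabsD _ _)) // cabsM !cabs_real.
by rewrite /cabs normc_def /= expr0n expr1n add0r sqrtr1 mul1r.
Qed.

(** Balls of [R[i]^o] have radii in [R[i]]; positivity forces these to be real,
    so real radii suffice. *)
Lemma nbhs_complexP (z : R[i]^o) (A : set R[i]^o) :
  nbhs z A <-> exists2 e : R, 0 < e & forall w, cabs (z - w) < e -> A w.
Proof.
split=> [/nbhs_ballP[e e0 eA]|[e e0 eA]].
  have er : real_complex R (complex.Re e) = e by rewrite RRe_real ?gtr0_real.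
  exists (complex.Re e); first by rewrite -ltcR er.
  by move=> w zw; apply: eA; rewrite -ball_normE /ball_ /= cabsE -er ltcR.
apply/nbhs_ballP; exists (real_complex R e); first by rewrite /= ltcR.
by move=> w; rewrite -ball_normE /ball_ /= cabsE ltcR => /eA.
Qed.

Lemma continuous_Re : continuous (@complex.Re R : R[i]^o -> R).
Proof.
move=> z A /nbhs_ballP[e e0 eA]; apply/nbhs_complexP; exists e => // w zw.
apply: eA; rewrite -ball_normE /ball_ /=; apply: le_lt_trans zw.
by rewrite -raddfB; apply: normr_Re_le.
Qed.

Lemma continuous_Im : continuous (@complex.Im R : R[i]^o -> R).
Proof.
move=> z A /nbhs_ballP[e e0 eA]; apply/nbhs_complexP; exists e => // w zw.
apply: eA; rewrite -ball_normE /ball_ /=; apply: le_lt_trans zw.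
by rewrite -raddfB; apply: normr_Im_le.
Qed.

Lemma continuous_cabs : continuous (cabs : R[i]^o -> R).
Proof.
move=> z A /nbhs_ballP[e e0 eA]; apply/nbhs_complexP; exists e => // w zw.
apply: eA; rewrite -ball_normE /ball_ /=; apply: le_lt_trans zw.
have h a b : cabs a - cabs b <= cabs (a - b) :> R.
  by rewrite lerBlDr (le_trans _ (cabsD _ _)) // subrK.
by rewrite ler_norml h andbT lerNl opprB cabsB_sym h.
Qed.

Lemma continuous_conj : continuous (Num.conj : R[i]^o -> R[i]^o).
Proof.
move=> z A /nbhs_complexP[e e0 eA]; apply/nbhs_complexP; exists e => // w zw.
by apply: eA; rewrite -rmorphB cabs_conj.
Qed.

Lemma continuous_hornerJ (f g : {poly R[i]}) :
  continuous (fun z : R[i]^o => f.[z] * (g.[z])^* : R[i]^o).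
Proof.
move=> z.
suff H : (fun w : R[i]^o => f.[w] * (g.[w])^* : R[i]^o) x @[x --> nbhs z] -->
    (f.[z] * (g.[z])^* : R[i]^o) by exact: H.
apply: (@cvgM R[i]); first exact: (@continuous_horner_numField R[i] f z).
apply: (continuous_comp (@continuous_horner_numField R[i] g z)).
exact: continuous_conj.
Qed.

End ComplexTopology.

(** * Measures on the complex plane and their support *)

Section Support.
Context {R : realType}.
Implicit Type mu : {finite_measure set (Borel_complex R) -> \bar R}.

Lemma measurable_open_complex (U : set R[i]^o) :
  open U -> measurable (U : set (Borel_complex R)).
Proof. by move=> oU; apply: sub_sigma_algebra. Qed.

Lemma open_cabs_lt (c : R[i]) (e : R) :
  open ([set w | cabs (c - w) < e] : set R[i]^o).
Proof.
rewrite openE => w /= cw; apply/nbhs_complexP.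
exists (e - cabs (c - w)); rewrite ?subr_gt0 // => v wv /=.
by rewrite -(subrKA w) (le_lt_trans (cabsD _ _)) // addrC -ltrBrDr.
Qed.

Lemma open_compl_supp mu : open (~` supp mu).
Proof.
rewrite openE => z /existsNP[U /not_implyP[oU /not_implyP[Uz muU]]].
move: (oU); rewrite openE => /(_ _ Uz); apply: filterS => w Uw.
by move=> /(_ U oU Uw).
Qed.

Lemma measurable_supp mu : measurable (supp mu : set (Borel_complex R)).
Proof.
rewrite -[supp mu]setCK; apply: measurableC.
exact: measurable_open_complex (@open_compl_supp mu).
Qed.

(** Balls with rational centre and radius [1 / (k + 1)]: a countable base of
    the topology. *)
Let rball (t : rat * rat * nat) : set R[i]^o :=
  [set w | cabs ((ratr t.1.1 +i* ratr t.1.2)%C - w) < (t.2.+1%:R)^-1 :> R].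

Lemma rball_between (z : R[i]) (e : R) : 0 < e ->
  exists t, rball t z /\ forall w, rball t w -> cabs (z - w) < e.
Proof.
move=> e0.
have [k /= ke] : exists k, (k.+1%:R)^-1 < e / 2 :> R.
  have [k ke] : exists k, (2 / e) < k%:R :> R.
    by exists (Num.truncn (2 / e)).+1; rewrite truncnS_gt.
  exists k; rewrite invf_plt ?posrE ?divr_gt0 // invf_div.
  by rewrite (lt_trans ke) // ltr_nat.
have k0 : 0 < (k.+1%:R)^-1 / 2 :> R by rewrite divr_gt0 // invr_gt0.
have H (x : R) : exists q : rat, `|ratr q - x| < (k.+1%:R)^-1 / 2.
  have /rat_in_itvoo[q] : x - (k.+1%:R)^-1 / 2 < x + (k.+1%:R)^-1 / 2.
    by rewrite ltrD2l; apply: lt_trans k0; rewrite oppr_lt0.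
  by rewrite in_itv /= -ltr_distl => h; exists q.
have [a ha] := H (complex.Re z); have [b hb] := H (complex.Im z).
have hz : cabs ((ratr a +i* ratr b)%C - z) < (k.+1%:R)^-1.
  rewrite (le_lt_trans (cabs_le_ReIm _)) // !raddfB /=.
  by rewrite [ltRHS]splitr ltrD.
exists (a, b, k); split=> // w; rewrite /rball /= => hw.
rewrite -(subrKA (ratr a +i* ratr b)%C) (le_lt_trans (cabsD _ _)) //.
rewrite cabsB_sym [ltRHS]splitr ltrD //; [exact: lt_trans hz ke|exact: lt_trans hw ke].
Qed.

(** Every point outside the support has a null neighbourhood, hence lies in a
    null ball of the countable base; countably many null balls form a null
    set. *)
Lemma measure_compl_supp mu : mu (~` supp mu) = 0%E.
Proof.
apply/negligibleP; first exact: measurable_open_complex (@open_compl_supp mu).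
pose F n : set (Borel_complex R) := if unpickle n is Some t then
  if mu (rball t) == 0%E then rball t else set0 else set0.
have : mu.-negligible (\bigcup_n F n).
  apply: negligible_bigcup => n; rewrite /F.
  case: unpickle => [t|]; last exact: negligible_set0.
  case: ifPn => [/eqP mu0|_]; last exact: negligible_set0.
  by apply/negligibleP => //; apply: measurable_open_complex; exact: open_cabs_lt.
apply: negligibleS => z /existsNP[U /not_implyP[oU /not_implyP[Uz muU]]].
have muU0 : mu U = 0%E.
  by apply/eqP; rewrite eq_le measure_ge0 andbT leNgt; apply/negP.
move: (oU); rewrite openE => /(_ _ Uz) /nbhs_complexP[e e0 eU].
have [t [tz tw]] := rball_between z e0.
have mt : measurable (rball t : set (Borel_complex R)).
  by apply: measurable_open_complex; exact: open_cabs_lt.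
exists (pickle t); [exact: I|]; rewrite /F pickleK.
have -> : mu (rball t) = 0%E.
  apply/eqP; rewrite -measure_le0 -muU0 le_measure ?inE //.
    exact: measurable_open_complex.
  by move=> w /tw/eU.
by rewrite eqxx.
Qed.

Lemma continuous_measurable_complex (g : R[i]^o -> R) : continuous g ->
  measurable_fun setT (g : Borel_complex R -> R).
Proof.
move=> cg; apply: (measurability _ (RGenOpens.measurableE R)).
move=> /= _ [_ [a [b ->]] <-]; rewrite setTI; apply: measurable_open_complex.
by move/continuousP: cg; apply; exact: interval_open.
Qed.

Section CompactSupport.
Variable mu : {finite_measure set (Borel_complex R) -> \bar R}.
Hypothesis mu_cpt : compact (supp mu).

Lemma continuous_bounded_supp (g : R[i]^o -> R) : continuous g ->
  exists M, forall z, supp mu z -> `|g z| <= M.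
Proof.
move=> cg; have /compact_bounded : compact (g @` supp mu).
  by apply: continuous_compact => //; exact: continuous_subspaceT.
move=> [M [_ hM]]; exists (M + 1) => z sz.
by apply: (hM (M + 1)); [rewrite ltrDl|exists z].
Qed.

(** On the support a continuous function is bounded by compactness, and the rest
    of the plane is null. *)
Lemma continuous_integrable (g : R[i]^o -> R) : continuous g ->
  mu.-integrable setT (EFin \o (g : Borel_complex R -> R)).
Proof.
move=> cg; have [M hM] := continuous_bounded_supp cg.
have mg := continuous_measurable_complex cg.
pose N : set (Borel_complex R) := ~` supp mu.
apply/(@negligible_integrable _ (Borel_complex R) R mu setT N) => //.
- by apply: measurableC; exact: measurable_supp.
- exact/measurable_EFinP.
- exact: measure_compl_supp.
rewrite setTD /N setCK; apply: measurable_bounded_integrable.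
- exact: measurable_supp.
- by rewrite ltey_eq fin_num_measure //; exact: measurable_supp.
- exact: measurable_funTS.
- exists M; split; rewrite ?num_real // => x Mx z sz /=.
  exact: le_trans (hM _ sz) (ltW Mx).
Qed.

Lemma cabs_le_supp_radius z : supp mu z -> cabs z <= supp_radius mu.
Proof.
move=> sz; apply: ub_le_sup; last by exists z.
have [M hM] := continuous_bounded_supp continuous_cabs.
by exists M => _ [w sw <-]; apply: le_trans (hM _ sw); exact: ler_norm.
Qed.

End CompactSupport.
End Support.

(** * The inner product of polynomials *)

Section InnerProduct.
Context {R : realType}.
Variable mu : {finite_measure set (Borel_complex R) -> \bar R}.
Hypothesis mu_cpt : compact (supp mu).

Lemma Rintegral_supp (g : R[i]^o -> R) : continuous g ->
  Rintegral mu setT g = Rintegral mu (supp mu) g.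
Proof.
move=> cg; congr fine; pose N : set (Borel_complex R) := ~` supp mu.
rewrite (@negligible_integral _ (Borel_complex R) R mu setT N) //.
- by rewrite setTD /N setCK.
- by apply: measurableC; exact: measurable_supp.
- exact: continuous_integrable.
- exact: measure_compl_supp.
Qed.

Lemma le_Rintegral_supp (g h : R[i]^o -> R) : continuous g -> continuous h ->
  (forall z, supp mu z -> g z <= h z) ->
  Rintegral mu setT g <= Rintegral mu setT h.
Proof.
move=> cg ch gh; rewrite !Rintegral_supp //.
have ms := @measurable_supp R mu.
by apply: le_Rintegral => //; apply: (integrableS measurableT ms) => //;
  exact: continuous_integrable.
Qed.

Lemma Rintegral_lin (a b : R) (g h k : R[i]^o -> R) :
  continuous g -> continuous h -> continuous k ->
  Rintegral mu setT (fun z => a * g z + b * h z + k z) =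
  a * Rintegral mu setT g + b * Rintegral mu setT h + Rintegral mu setT k.
Proof.
move=> cg ch ck.
have cZ (c : R) (l : R[i]^o -> R) : continuous l -> continuous (fun z => c * l z).
  by move=> cl z; apply: (continuous_comp (cl z)); exact: mulrl_continuous.
have iZ c l cl := continuous_integrable mu_cpt (cZ c l cl).
have iC l cl := @continuous_integrable R mu mu_cpt l cl.
rewrite RintegralD //; [|apply: iC|exact: iC].
  by rewrite RintegralD ?RintegralZl //; [exact: iC|exact: iC|exact: iZ|exact: iZ].
by move=> z; exact: (cvgD (cZ a g cg z) (cZ b h ch z)).
Qed.

Lemma Cintegral_lin (a : R[i]) (F G : R[i]^o -> R[i]^o) :
  continuous F -> continuous G ->
  Cintegral mu (fun z => a * F z + G z) = a * Cintegral mu F + Cintegral mu G.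
Proof.
move=> cF cG.
have cRe (H : R[i]^o -> R[i]^o) (cH : continuous H) : continuous (fun z => complex.Re (H z)).
  by move=> z; apply: (continuous_comp (cH z)); exact: continuous_Re.
have cIm (H : R[i]^o -> R[i]^o) (cH : continuous H) : continuous (fun z => complex.Im (H z)).
  by move=> z; apply: (continuous_comp (cH z)); exact: continuous_Im.
rewrite /Cintegral.
have -> : (fun z => complex.Re (a * F z + G z)) = (fun z =>
    complex.Re a * complex.Re (F z) + (- complex.Im a) * complex.Im (F z) + complex.Re (G z)).
  by apply/funext => z; case: a (F z) (G z) => [a1 a2] [b1 b2] [c1 c2] /=; rewrite mulNr.
have -> : (fun z => complex.Im (a * F z + G z)) = (fun z =>
    complex.Re a * complex.Im (F z) + complex.Im a * complex.Re (F z) + complex.Im (G z)).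
  by apply/funext => z; case: a (F z) (G z) => [a1 a2] [b1 b2] [c1 c2].
rewrite !Rintegral_lin; try by [exact: cRe|exact: cIm].
by case: a => a1 a2; rewrite mulNr.
Qed.

Lemma Cintegral_conj (F : R[i]^o -> R[i]^o) : continuous F ->
  Cintegral mu (fun z => (F z)^*) = (Cintegral mu F)^*.
Proof.
move=> cF; rewrite /Cintegral.
have cIm : continuous (fun z => complex.Im (F z)).
  by move=> z; apply: (continuous_comp (cF z)); exact: continuous_Im.
congr Complex; first by congr Rintegral; apply/funext => z; case: (F z).
transitivity (Rintegral mu setT (fun z => -1 * complex.Im (F z))).
  by congr Rintegral; apply/funext => z; case: (F z) => a b; rewrite mulN1r.
by rewrite RintegralZl ?mulN1r //; exact: continuous_integrable.
Qed.

Definition inner_prod (f g : {poly R[i]}) : R[i] :=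
  Cintegral mu (fun z => f.[z] * (g.[z])^*).

Lemma inner_prod_lin a f g h :
  inner_prod (a *: f + g) h = a * inner_prod f h + inner_prod g h.
Proof.
rewrite /inner_prod -(Cintegral_lin a (@continuous_hornerJ _ f h) (@continuous_hornerJ _ g h)).
by congr Cintegral; apply/funext => z; rewrite hornerD hornerZ mulrDl mulrA.
Qed.

Lemma inner_prod_conj f g : inner_prod g f = (inner_prod f g)^*.
Proof.
rewrite /inner_prod -(Cintegral_conj (@continuous_hornerJ _ f g)).
by congr Cintegral; apply/funext => z; rewrite rmorphM /= conjCK mulrC.
Qed.

Lemma continuous_cabs_horner2 (f : {poly R[i]}) :
  continuous (fun z : R[i]^o => cabs f.[z] ^+ 2).
Proof.
move=> z; apply: (continuous_comp _ (@exprn_continuous R 2 _)).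
by apply: (continuous_comp (@continuous_horner_numField R[i] f z)); exact: continuous_cabs.
Qed.

Lemma inner_prod_norm f :
  inner_prod f f = real_complex R (Rintegral mu setT (fun z => cabs f.[z] ^+ 2)).
Proof.
have h z : f.[z] * (f.[z])^* = real_complex R (cabs f.[z] ^+ 2).
  by rewrite -normCK cabsE rmorphXn.
rewrite /inner_prod /Cintegral; congr Complex.
  by congr Rintegral; apply/funext => z; rewrite h.
transitivity (Rintegral mu setT (fun _ => 0 : R)).
  by congr Rintegral; apply/funext => z; rewrite h.
by rewrite Rintegral_cst // mul0r.
Qed.

Lemma inner_prod_ge0 f : 0 <= inner_prod f f.
Proof.
rewrite inner_prod_norm ler0c Rintegral_ge0 // => z _.
by rewrite exprn_ge0 ?cabs_ge0.
Qed.

Lemma supp_radius_ge0 : supp mu !=set0 -> 0 <= supp_radius mu.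
Proof.
by move=> [z sz]; apply: le_trans (cabs_le_supp_radius mu_cpt sz); exact: cabs_ge0.
Qed.

(** The radius of the support enters here: multiplication
    by [z] has norm at most [M] when the support lies in the disc of radius
    [M]. *)
Lemma inner_prod_mulX (M : R) f : 0 <= M -> (forall z, supp mu z -> cabs z <= M) ->
  inner_prod ('X * f) ('X * f) <= real_complex R M ^+ 2 * inner_prod f f.
Proof.
move=> M0 hM; rewrite !inner_prod_norm -rmorphXn -rmorphM lecR.
rewrite -RintegralZl //; last exact: continuous_integrable (@continuous_cabs_horner2 f).
apply: le_Rintegral_supp.
- exact: continuous_cabs_horner2.
- move=> z; apply: (continuous_comp (@continuous_cabs_horner2 f z)).
  exact: mulrl_continuous.
move=> z /hM zM; rewrite hornerM hornerX cabsM exprMn.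
by rewrite ler_wpM2r ?exprn_ge0 ?cabs_ge0 // ler_pXn2r ?nnegrE ?cabs_ge0.
Qed.

End InnerProduct.

(** * Compressions of multiplication by the variable *)

(** From here on only the algebraic properties of the inner product are used,
    so [ip] is any positive semidefinite Hermitian form on polynomials for
    which multiplication by ['X] is bounded and [p] is orthonormal with positive leading
    coefficients. *)

Section CompressedShift.
Variables (C : numClosedFieldType) (ip : {poly C} -> {poly C} -> C).
Variables (rho : C) (p : nat -> {poly C}).
Hypothesis ip_lin : forall a f g h, ip (a *: f + g) h = a * ip f h + ip g h.
Hypothesis ip_conj : forall f g, ip g f = (ip f g)^*.
Hypothesis ip_ge0 : forall f, 0 <= ip f f.
Hypothesis rho_ge0 : 0 <= rho.
Hypothesis ip_mulX : forall f, ip ('X * f) ('X * f) <= rho ^+ 2 * ip f f.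
Hypothesis size_p : forall n, size (p n) = n.+1.
Hypothesis lead_p : forall n, 0 < lead_coef (p n).
Hypothesis ip_p : forall n m, ip (p n) (p m) = (m == n)%:R.

Lemma ip0l h : ip 0 h = 0.
Proof.
have := ip_lin 1 0 0 h; rewrite scaler0 add0r mul1r => /esym/eqP.
by rewrite -subr_eq0 addrK => /eqP.
Qed.

Lemma ipDl f g h : ip (f + g) h = ip f h + ip g h.
Proof. by have := ip_lin 1 f g h; rewrite scale1r mul1r. Qed.

Lemma ipZl a f h : ip (a *: f) h = a * ip f h.
Proof. by have := ip_lin a f 0 h; rewrite addr0 ip0l addr0. Qed.

Lemma ipBl f g h : ip (f - g) h = ip f h - ip g h.
Proof. by rewrite -scaleN1r ipDl ipZl mulN1r. Qed.

Lemma ipDr f g h : ip f (g + h) = ip f g + ip f h.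
Proof. by rewrite ip_conj ipDl rmorphD /= -!ip_conj. Qed.

Lemma ipZr a f h : ip f (a *: h) = a^* * ip f h.
Proof. by rewrite ip_conj ipZl rmorphM /= -ip_conj. Qed.

Lemma ipBr f g h : ip f (g - h) = ip f g - ip f h.
Proof. by rewrite ip_conj ipBl rmorphB /= -!ip_conj. Qed.

Lemma ip_suml n (F : 'I_n -> {poly C}) h : ip (\sum_i F i) h = \sum_i ip (F i) h.
Proof. by elim/big_rec2 : _ => [|i y1 y2 _ <-]; rewrite ?ip0l ?ipDl. Qed.

Lemma lead_neq0 n : lead_coef (p n) != 0.
Proof. by rewrite gt_eqF. Qed.

Lemma coef_lead n : (p n)`_n = lead_coef (p n).
Proof. by rewrite lead_coefE size_p. Qed.

(** One step of the expansion of [f] along [p]: it removes the coefficient of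
    degree [n]. *)
Lemma size_sub_lead n (f : {poly C}) : (size f <= n.+1)%N ->
  (size (f - (f`_n / lead_coef (p n)) *: p n)%R <= n)%N.
Proof.
move=> sf; apply/leq_sizeP => j; rewrite leq_eqVlt => /predU1P[<-|nj].
  by rewrite coefB coefZ coef_lead divfK ?subrr ?lead_neq0.
rewrite coefB coefZ [f`_j]nth_default ?(leq_trans sf) //.
by rewrite [(p n)`_j]nth_default ?size_p // mulr0 subrr.
Qed.

Lemma ip_size_le n (f : {poly C}) : (size f <= n)%N -> ip f (p n) = 0.
Proof.
suff H m (g : {poly C}) : (size g <= m)%N -> (m <= n)%N -> ip g (p n) = 0 by move/H; apply.
elim: m g => [|m IH] g sg mn.
  by move: sg; rewrite leqn0 size_poly_eq0 => /eqP->; rewrite ip0l.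
rewrite -[g](subrK ((g`_m / lead_coef (p m)) *: p m)) ipDl IH ?size_sub_lead ?(ltnW mn) //.
by rewrite ipZl ip_p gtn_eqF // mulr0 addr0.
Qed.

Lemma ip_lead n (f : {poly C}) : (size f <= n.+1)%N ->
  ip f (p n) = f`_n / lead_coef (p n).
Proof.
move=> sf; rewrite -{1}[f](subrK ((f`_n / lead_coef (p n)) *: p n)) ipDl.
by rewrite ip_size_le ?size_sub_lead // ipZl ip_p eqxx mulr1 add0r.
Qed.

Lemma ip_expand n (f : {poly C}) : (size f <= n)%N ->
  f = \sum_(l < n) ip f (p l) *: p l.
Proof.
elim: n f => [|n IH] f sf.
  by rewrite big_ord0; apply/eqP; rewrite -size_poly_eq0 -leqn0.
rewrite big_ord_recr /= ip_lead // -{1}[f](subrK ((f`_n / lead_coef (p n)) *: p n)).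
congr (_ + _); rewrite {1}(IH _ (size_sub_lead sf)); apply: eq_bigr => l _.
by rewrite ipBl ipZl ip_p ltn_eqF // mulr0 subr0.
Qed.

Definition nrm f := sqrtC (ip f f).

Lemma nrm_ge0 f : 0 <= nrm f. Proof. by rewrite sqrtC_ge0. Qed.

Lemma nrmK f : nrm f ^+ 2 = ip f f. Proof. exact: sqrtCK. Qed.

Lemma ip_proj f n :
  ip (f - ip f (p n) *: p n) (f - ip f (p n) *: p n) = ip f f - `|ip f (p n)| ^+ 2.
Proof.
rewrite !(ipBl, ipBr, ipZl, ipZr) ip_p eqxx mulr1 normCK [ip (p n) f]ip_conj.
by rewrite [_^* * _]mulrC subrr subr0.
Qed.

Lemma nrmZ a f : nrm (a *: f) = `|a| * nrm f.
Proof.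
by rewrite /nrm ipZl ipZr mulrA -normCK sqrtCM ?nnegrE ?exprn_ge0 // sqrCK.
Qed.

Lemma ler_nrm f x : 0 <= x -> ip f f <= x ^+ 2 -> nrm f <= x.
Proof. by move=> x0; rewrite -nrmK ler_pXn2r ?nnegrE ?nrm_ge0. Qed.

Lemma bessel f n : `|ip f (p n)| <= nrm f.
Proof.
rewrite -(@ler_pXn2r _ 2) ?nnegrE ?nrm_ge0 ?normr_ge0 // nrmK.
by rewrite -subr_ge0 -ip_proj.
Qed.

Lemma ip_eq0 f : ip f f = 0 -> f = 0.
Proof.
move=> f0; rewrite (ip_expand (leqnn (size f))); apply: big1 => l _.
have := bessel f l; rewrite /nrm f0 sqrtC0 normr_le0 => /eqP->.
by rewrite scale0r.
Qed.

Lemma nrm_p n : nrm (p n) = 1.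
Proof. by rewrite /nrm ip_p eqxx sqrtC1. Qed.

Lemma nrm_proj f n : nrm (f - ip f (p n) *: p n) <= nrm f.
Proof.
apply: ler_nrm; first exact: nrm_ge0.
by rewrite ip_proj nrmK gerBl exprn_ge0.
Qed.

Lemma nrm_mulX f : nrm ('X * f) <= rho * nrm f.
Proof.
apply: ler_nrm; first by rewrite mulr_ge0 ?nrm_ge0.
by rewrite exprMn nrmK.
Qed.

(** The triangle inequality, in the one case that the resolvent needs; for a
    unit vector [p n] it follows from Bessel's inequality without
    Cauchy-Schwarz. *)
Lemma nrm_p_add n g : nrm (p n + g) <= 1 + nrm g.
Proof.
apply: ler_nrm; first by rewrite addr_ge0 ?nrm_ge0.
rewrite -[leLHS]ger0_norm // !(ipDl, ipDr) ip_p eqxx [ip (p n) g]ip_conj.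
have h := bessel g n.
have -> : (1 + nrm g) ^+ 2 = (1 + nrm g) + (nrm g + nrm g ^+ 2) by ring.
rewrite nrmK (le_trans (ler_normD _ _)) // lerD // (le_trans (ler_normD _ _)) //.
  by rewrite lerD // ?normr1 // norm_conjC.
by rewrite lerD // ger0_norm.
Qed.

(** On polynomials of degree less than [n] this is multiplication by ['X]
    followed by orthogonal projection to that space, since only the component
    along [p n] leaves it ([size_cshift]). *)
Definition cshift n f : {poly C} := 'X * f - ip ('X * f) (p n) *: p n.

Lemma nrm_cshift n f : nrm (cshift n f) <= rho * nrm f.
Proof. exact: le_trans (nrm_proj _ _) (nrm_mulX f). Qed.

Lemma nrm_iter_cshift n k f : nrm (iter k (cshift n) f) <= rho ^+ k * nrm f.
Proof.
elim: k => [|k IH]; first by rewrite expr0 mul1r.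
by rewrite iterS exprS -mulrA (le_trans (nrm_cshift _ _)) // ler_wpM2l.
Qed.

Lemma size_mulX_le (f : {poly C}) n : (size f <= n)%N -> (size ('X * f)%R <= n.+1)%N.
Proof.
move=> sf; have [->|f0] := eqVneq f 0; first by rewrite mulr0 size_poly0.
by rewrite mulrC size_mulX.
Qed.

Lemma size_cshift n (f : {poly C}) : (size f <= n)%N -> (size (cshift n f) <= n)%N.
Proof. by move=> sf; rewrite /cshift ip_lead ?size_sub_lead ?size_mulX_le. Qed.

Lemma size_iter_cshift n k (f : {poly C}) :
  (size f <= n)%N -> (size (iter k (cshift n) f) <= n)%N.
Proof. by move=> sf; elim: k => // k IH; rewrite iterS size_cshift. Qed.

Lemma iter_cshiftD n k f g :
  iter k (cshift n) (f + g) = iter k (cshift n) f + iter k (cshift n) g.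
Proof.
elim: k => // k IH; rewrite !iterS IH /cshift mulrDr ipDl scalerDl opprD.
by rewrite addrACA.
Qed.

Lemma iter_cshiftZ n k a f : iter k (cshift n) (a *: f) = a *: iter k (cshift n) f.
Proof.
elim: k => // k IH; rewrite !iterS IH /cshift -scalerAr ipZl -scalerA.
by rewrite -scalerBr.
Qed.

Lemma ip_cshift n f m : (m < n)%N -> ip (cshift n f) (p m) = ip ('X * f) (p m).
Proof. by move=> mn; rewrite ipBl ipZl ip_p ltn_eqF // mulr0 subr0. Qed.

Lemma ip_mulX_succ n : ip ('X * p n) (p n.+1) = lead_coef (p n) / lead_coef (p n.+1).
Proof.
by rewrite ip_lead ?size_mulX_le ?size_p // coefXM /= coef_lead.
Qed.

(** Consecutive leading coefficients have as quotient a subdiagonal entry of the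
    Bergman shift matrix, at most [rho] by Bessel's inequality. *)
Lemma lead_ratio N i : (i <= N)%N -> lead_coef (p (N - i)) / lead_coef (p N) <= rho ^+ i.
Proof.
elim: i => [|i IH] iN; first by rewrite subn0 divff ?lead_neq0 ?expr0.
have -> : lead_coef (p (N - i.+1)) / lead_coef (p N) =
    lead_coef (p (N - i.+1)) / lead_coef (p (N - i)) * (lead_coef (p (N - i)) / lead_coef (p N)).
  by rewrite mulrA divfK ?lead_neq0.
rewrite exprS.
apply: ler_pM; rewrite ?divr_ge0 ?(ltW (lead_p _)) ?IH ?(ltnW iN) //.
rewrite -(subnSK iN) -ip_mulX_succ -[leLHS]ger0_norm; last first.
  by rewrite ip_mulX_succ divr_ge0 ?(ltW (lead_p _)).
by rewrite (le_trans (bessel _ _)) // (le_trans (nrm_mulX _)) // nrm_p mulr1.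
Qed.

(** The coefficient of the monic polynomial [P_(N-i)] in the expansion of
    [T^k P_N], where [T = cshift N.+1]; the quotient of leading coefficients
    converts from the orthonormal to the monic basis. *)
Definition power_coef N k i : C :=
  lead_coef (p (N - i)) / lead_coef (p N) * ip (iter k (cshift N.+1) (p N)) (p (N - i)).

Lemma power_coef0 N i : (i <= N)%N -> power_coef N 0 i = (i == 0%N)%:R.
Proof.
move=> iN; rewrite /power_coef /= ip_p; have [->|i0] := eqVneq i 0%N.
  by rewrite subn0 eqxx divff ?lead_neq0 ?mulr1.
rewrite [_ == N]ltn_eqF ?mulr0 // ltn_subrL.
by rewrite lt0n i0 (leq_trans _ iN) // lt0n.
Qed.

Lemma power_coef_le N k i : (i <= N)%N -> `|power_coef N k i| <= rho ^+ (k + i).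
Proof.
move=> iN; rewrite normrM addnC exprD.
have r0 : 0 <= lead_coef (p (N - i)) / lead_coef (p N).
  by rewrite divr_ge0 ?(ltW (lead_p _)).
apply: ler_pM => //; first by rewrite ger0_norm ?lead_ratio.
by rewrite (le_trans (bessel _ _)) // (le_trans (nrm_iter_cshift _ _ _)) // nrm_p mulr1.
Qed.

(** Apply [T] once more to the expansion of [T^k P_N] in the [P_(N-l)]: the
    matrix of [T] is upper Hessenberg, so only [l <= i + 1] contributes to
    [P_(N-i)], and the subdiagonal entry [l = i + 1] is 1 in the monic basis. *)
Lemma power_coef_rec N k i : (i < N)%N ->
  power_coef N k.+1 i = power_coef N k i.+1 +
    \sum_(l < i.+1) power_coef N k l * power_coef (N - l) 1 (i - l).
Proof.
move=> iN; set g := iter k (cshift N.+1) (p N).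
have sg : (size g <= N.+1)%N by rewrite size_iter_cshift ?size_p.
have e1 : ip (cshift N.+1 g) (p (N - i)) =
    \sum_(l < N.+1) ip g (p l) * ip ('X * p l) (p (N - i)).
  rewrite ip_cshift ?ltnS ?leq_subr // {1}(ip_expand sg) mulr_sumr ip_suml.
  by apply: eq_bigr => l _; rewrite -scalerAr ipZl.
have e2 : ip (cshift N.+1 g) (p (N - i)) =
    \sum_(l < i.+2) ip g (p (N - l)) * ip ('X * p (N - l)) (p (N - i)).
  (* Terms with [l >= i + 2] vanish: ['X * p (N - l)] has too small a degree. *)
  rewrite e1 (reindex_inj rev_ord_inj) /=.
  under eq_bigr do rewrite subSS.
  rewrite -(big_mkord xpredT (fun l => ip g (p (N - l)) * ip ('X * p (N - l)) (p (N - i)))).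
  rewrite -(big_mkord xpredT (fun l => ip g (p (N - l)) * ip ('X * p (N - l)) (p (N - i)))).
  rewrite (big_cat_nat _ (n := i.+2)) //= [X in _ + X]big_nat [X in _ + X]big1 ?addr0 //.
  move=> l /andP[il lN]; rewrite [X in _ * X]ip_size_le ?mulr0 //.
  by apply: leq_trans (size_mulX_le (leqnn _)) _; rewrite size_p; lia.
rewrite /power_coef iterS -/g e2 big_ord_recr /= mulrDr addrC; congr (_ + _).
  rewrite -(subnSK iN) ip_mulX_succ.
  by field; rewrite !lead_neq0.
rewrite mulr_sumr; apply: eq_bigr => l _.
rewrite ip_cshift; last by rewrite ltnS leq_subr.
have -> : (N - l - (i - l) = N - i)%N by have := ltn_ord l; lia.
by field; rewrite !lead_neq0.
Qed.

(** A root [z] of [p n] is an eigenvalue of [cshift n], with eigenvector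
    [p n / ('X - z)], so its modulus cannot exceed the norm of [cshift n]. *)
Lemma orthonormal_neq0 z n : rho < `|z| -> (p n).[z] != 0.
Proof.
move=> rz; apply/negP => /factor_theorem[w pw].
have p0 : p n != 0 by rewrite -lead_coef_eq0 lead_neq0.
have w0 : w != 0 by apply: contraNneq p0 => w0; rewrite pw w0 mul0r.
have sw : (size w <= n)%N.
  have := size_p n; rewrite pw size_Mmonic ?monicXsubC // size_XsubC addn2 /=.
  by move=> [->].
have Xw : 'X * w = z *: w + p n by rewrite pw -mul_polyC; ring.
have Tw : cshift n w = z *: w.
  rewrite /cshift {2}Xw ipDl ipZl (ip_size_le sw) mulr0 ip_p eqxx add0r scale1r.
  by rewrite Xw addrK.
have := nrm_cshift n w; rewrite Tw nrmZ.
have nw : 0 < nrm w.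
  rewrite lt_def nrm_ge0 andbT; apply: contra w0 => /eqP h.
  by apply/eqP/ip_eq0; rewrite -nrmK h expr0n.
by rewrite ler_pM2r // => /(lt_le_trans rz); rewrite ltxx.
Qed.

(** Since [p N - g * p N.+1] vanishes at [z] for [g = p N (z) / p N.+1 (z)], its
    quotient [u] by [z - 'X] is a polynomial of degree at most [N]; compressing
    [(z - 'X) u] cancels the multiple of [p N.+1], so [u] is the resolvent of
    the compressed shift at [z] applied to [p N].  The component of [u] along
    [p N] is read off its leading coefficient and equals the ratio of the
    monic polynomials. *)
Lemma cshift_resolvent z N : rho < `|z| -> exists u : {poly C},
  [/\ z *: u = p N + cshift N.+1 u,
      ip u (p N) = ((lead_coef (p N))^-1 * (p N).[z])
                   / ((lead_coef (p N.+1))^-1 * (p N.+1).[z])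
    & nrm u <= (`|z| - rho)^-1].
Proof.
move=> rz; have pz := orthonormal_neq0 N.+1 rz.
pose g := (p N).[z] / (p N.+1).[z].
have /factor_theorem[w hw] : root (p N - g *: p N.+1) z.
  by rewrite /root hornerD hornerN hornerZ divfK // subrr.
pose u := - w.
have zu : z *: u = p N + 'X * u - g *: p N.+1.
  by rewrite addrAC hw /u -mul_polyC; ring.
have su : (size u <= N.+1)%N.
  rewrite size_polyN; have [->|w0] := eqVneq w 0; first by rewrite size_poly0.
  have : (size (p N - g *: p N.+1)%R <= N.+2)%N.
    rewrite (leq_trans (size_polyD _ _)) // geq_max size_p leqnSn size_polyN.
    by rewrite (leq_trans (size_scale_leq _ _)) // size_p.
  by rewrite hw size_Mmonic ?monicXsubC // size_XsubC addn2.
have gE : ip ('X * u) (p N.+1) = g.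
  have := congr1 (fun f => ip f (p N.+1)) zu.
  rewrite /= ipBl ipDl !ipZl (ip_size_le su) !ip_p eqxx mulr0 mulr1.
  by rewrite gtn_eqF // add0r => /esym/eqP; rewrite subr_eq0 => /eqP.
have zuT : z *: u = p N + cshift N.+1 u by rewrite zu /cshift gE addrA.
exists u; split => //.
  rewrite ip_lead //.
  have : u`_N = g * lead_coef (p N.+1).
    by move: gE; rewrite ip_lead ?size_mulX_le // coefXM /= => <-; rewrite divfK ?lead_neq0.
  by move=> ->; rewrite /g; field; rewrite pz !lead_neq0.
have h : `|z| * nrm u <= 1 + rho * nrm u.
  by rewrite -nrmZ zuT (le_trans (nrm_p_add _ _)) // lerD2l nrm_cshift.
by rewrite -[leRHS]mul1r ler_pdivlMr ?subr_gt0 // mulrC mulrBl lerBlDr.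
Qed.

(** The Neumann series of the resolvent, with remainder. *)
Lemma ratio_expansion z N K : rho < `|z| ->
  `| ((lead_coef (p N))^-1 * (p N).[z]) / ((lead_coef (p N.+1))^-1 * (p N.+1).[z])
     - \sum_(k < K) power_coef N k 0 * z ^- k.+1 |
  <= (rho / `|z|) ^+ K / (`|z| - rho).
Proof.
move=> rz; have [u [zu <- nu]] := cshift_resolvent N rz.
have z0 : z != 0 by rewrite -normr_gt0 (le_lt_trans rho_ge0 rz).
have step k : ip (iter k (cshift N.+1) u) (p N) =
    z^-1 * (power_coef N k 0 + ip (iter k.+1 (cshift N.+1) u) (p N)).
  apply: (mulfI z0); rewrite mulrA mulfV // mul1r -ipZl.
  rewrite /power_coef subn0 divff ?lead_neq0 // mul1r -ipDl iterSr; congr ip.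
  by rewrite -iter_cshiftZ zu iter_cshiftD.
have -> : ip u (p N) - \sum_(k < K) power_coef N k 0 * z ^- k.+1 =
    z ^- K * ip (iter K (cshift N.+1) u) (p N).
  elim: K => [|K IH]; first by rewrite big_ord0 subr0 expr0 invr1 mul1r.
  by rewrite big_ord_recr /= opprD addrA IH step exprSr; field; rewrite z0 expf_neq0.
rewrite normrM normfV normrX mulrC expr_div_n mulrAC ler_pM ?invr_ge0 ?exprn_ge0 //.
rewrite (le_trans (bessel _ _)) // (le_trans (nrm_iter_cshift _ _ _)) //.
by rewrite ler_wpM2l ?exprn_ge0.
Qed.

End CompressedShift.

(** * Sequences of complex numbers tending to zero *)

Section Vanishing.
Context {R : realType}.
Implicit Types u v : nat -> R[i].

Definition vanishing u := forall e : R, 0 < e -> \forall n \near \oo, cabs (u n) < e.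

Lemma vanishingP u : (u : nat -> R[i]^o) @ \oo --> (0 : R[i]^o) <-> vanishing u.
Proof.
split=> [cu e e0|vu A /nbhs_complexP[e e0 eA]].
  have : nbhs (0 : R[i]^o) [set w | cabs (0 - w) < e] by apply/nbhs_complexP; exists e.
  move=> /cu h; have {}h : \forall n \near \oo, cabs (0 - u n) < e by exact: h.
  by apply: filterS h => n; rewrite sub0r cabsN.
by apply: filterS (vu e e0) => n h; apply: eA; rewrite sub0r cabsN.
Qed.

Lemma vanishing_near u v : (\forall n \near \oo, u n = v n) -> vanishing u -> vanishing v.
Proof.
by move=> uv vu e e0; near=> n; rewrite -(near uv n) //; near: n; exact: vu.
Unshelve. all: by end_near. Qed.

Lemma vanishing0 : vanishing (fun=> 0).
Proof. by move=> e e0; near=> n; rewrite cabs0. Unshelve. all: by end_near. Qed.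

Lemma vanishingD u v : vanishing u -> vanishing v -> vanishing (fun n => u n + v n).
Proof.
move=> vu vv e e0; have e2 : 0 < e / 2 by rewrite divr_gt0.
near=> n; rewrite (le_lt_trans (cabsD _ _)) // [ltRHS]splitr ltrD //; near: n.
  exact: vu.
exact: vv.
Unshelve. all: by end_near. Qed.

Lemma vanishingM (B : R) u v : vanishing u -> (\forall n \near \oo, cabs (v n) <= B) ->
  vanishing (fun n => v n * u n).
Proof.
move=> vu vB e e0; have B0 : 0 < `|B| + 1 by rewrite ltr_wpDl.
near=> n; rewrite cabsM (@le_lt_trans _ _ ((`|B| + 1) * cabs (u n))) //.
  rewrite ler_wpM2r ?cabs_ge0 // (@le_trans _ _ B) //; first by near: n.
  by rewrite (le_trans (ler_norm B)) // lerDl.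
rewrite mulrC -ltr_pdivlMr //; near: n; apply: vu; exact: divr_gt0.
Unshelve. all: by end_near. Qed.

Lemma vanishingZ c u : vanishing u -> vanishing (fun n => c * u n).
Proof.
by move=> vu; apply: (@vanishingM (cabs c)) => //; near=> n.
Unshelve. all: by end_near. Qed.

Lemma vanishingN u : vanishing u -> vanishing (fun n => - u n).
Proof.
by move=> vu; apply: vanishing_near (vanishingZ (-1) vu); near=> n; rewrite mulN1r.
Unshelve. all: by end_near. Qed.

Lemma vanishing_sum k (F : 'I_k -> nat -> R[i]) :
  (forall i, vanishing (F i)) -> vanishing (fun n => \sum_i F i n).
Proof.
elim: k F => [|k IH] F vF.
  by apply: vanishing_near vanishing0; near=> n; rewrite big_ord0.
apply: vanishing_near (vanishingD (IH _ (fun i => vF (widen_ord (leqnSn k) i))) (vF ord_max)).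
by near=> n; rewrite big_ord_recr.
Unshelve. all: by end_near. Qed.

Lemma vanishing_shift l u : vanishing u -> vanishing (fun n => u (n - l)%N).
Proof.
move=> vu e /vu[N _ hN]; near=> n; apply: hN => /=.
by rewrite leq_subRL; near: n; [exact: nbhs_infty_ge|exists l].
Unshelve. all: by end_near. Qed.

Lemma vanishing_succ u : vanishing (fun n => u n.+1) <-> vanishing u.
Proof.
split=> vu.
  apply: vanishing_near (vanishing_shift 1 vu); near=> n.
  by rewrite subn1 prednK //; near: n; exact: nbhs_infty_gt.
move=> e /vu[N _ hN]; near=> n; apply: hN => /=.
by apply: leqW; near: n; exact: nbhs_infty_ge.
Unshelve. all: by end_near. Qed.

Lemma vanishing_approx u :
  (forall e : R, 0 < e -> exists2 v, vanishing v & forall n, cabs (u n - v n) <= e) ->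
  vanishing u.
Proof.
move=> uv e e0; have e2 : 0 < e / 2 by rewrite divr_gt0.
have [v vv huv] := uv _ e2; near=> n.
rewrite -(subrK (v n) (u n)) (le_lt_trans (cabsD _ _)) // [ltRHS]splitr ler_ltD //.
by near: n; exact: vv.
Unshelve. all: by end_near. Qed.

End Vanishing.

(** * Laurent coefficients and shift coefficients *)

Section Comparison.
Context {R : realType}.
Variables (M : R) (q : nat) (A B : nat -> nat -> nat -> R[i]).

(** What the comparison of two measures needs to know about [power_coef]. *)
Definition power_array (A : nat -> nat -> nat -> R[i]) :=
  [/\ forall N i, (i <= N)%N -> A N 0%N i = (i == 0%N)%:R,
      forall N k i, (i <= N)%N -> cabs (A N k i) <= M ^+ (k + i) &
      forall N k i, (i < N)%N ->
        A N k.+1 i = A N k i.+1 + \sum_(l < i.+1) A N k l * A (N - l)%N 1%N (i - l)%N].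

Hypotheses (hA : power_array A) (hB : power_array B).

Let D k i N := A N k i - B (N - q)%N k i.

(** Subtract the two recurrences and write each difference of products as
    [x y - x' y' = x (y - y') + y' (x - x')]. *)
Let vanishing_step k i :
  (forall l, (l <= i)%N -> vanishing (D k l)) ->
  (forall j, (j <= i)%N -> vanishing (D 1 j)) ->
  vanishing (fun N => D k.+1 i N - D k i.+1 N).
Proof.
move=> vk v1; have [_ leA recA] := hA; have [_ leB recB] := hB.
pose F (l : 'I_i.+1) N := A N k l * D 1 (i - l) (N - l)%N
  + B (N - q - l)%N 1%N (i - l)%N * D k l N.
have vF : vanishing (fun N => \sum_l F l N).
  apply: vanishing_sum => l; have li : (l <= i)%N by rewrite -ltnS.
  apply: vanishingD.
    apply: (@vanishingM _ (M ^+ (k + l))).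
      by apply: (@vanishing_shift R l (D 1 (i - l))); apply: v1; exact: leq_subr.
    by near=> N; apply: leA; near: N; exact: nbhs_infty_ge.
  apply: (@vanishingM _ (M ^+ (1 + (i - l)))); first exact: vk.
  near=> N; apply: leB.
  by have : (q + i + l <= N)%N; [near: N; exact: nbhs_infty_ge|lia].
apply: vanishing_near vF; near=> N.
have qiN : (q + i < N)%N by near: N; exact: nbhs_infty_gt.
rewrite /D recA; last by lia.
rewrite recB; last by lia.
rewrite opprD addrACA [X in _ = X - _]addrC addrK -sumrB; apply: eq_bigr => l _.
rewrite /F /D [(N - l - q)%N]subnAC; ring.
Unshelve. all: by end_near. Qed.

(** By the recurrence, [A N k i] depends only on the [A _ 1 j] with
    [j < k + i]. *)
Let vanishing_lower K : (forall j, (j < K)%N -> vanishing (D 1 j)) ->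
  forall k i, (k + i <= K)%N -> vanishing (D k i).
Proof.
move=> v1; elim=> [|k IH] i kiK.
  apply: vanishing_near vanishing0; near=> N.
  have qiN : (q + i <= N)%N by near: N; exact: nbhs_infty_ge.
  have [A0 _ _] := hA; have [B0 _ _] := hB.
  by rewrite /D A0 ?B0 ?subrr //; lia.
have h : vanishing (fun N => D k.+1 i N - D k i.+1 N).
  by apply: vanishing_step => [l li|j ji]; [apply: IH; lia|apply: v1; lia].
have h' : vanishing (D k i.+1) by apply: IH; lia.
apply: vanishing_near (vanishingD h h').
by near=> N; rewrite subrK.
Unshelve. all: by end_near. Qed.

(** Along an antidiagonal [k.+1 + i = K.+1], consecutive entries differ by terms
    that involve only [A _ 1 j] with [j < K]; the walk ends at [A N 1 K]. *)
Let vanishing_top K : (forall j, (j < K)%N -> vanishing (D 1 j)) ->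
  forall k i, (k + i = K)%N -> vanishing (D k.+1 i) -> vanishing (D 1 K).
Proof.
move=> v1; elim=> [|k IH] i kiK; first by rewrite -kiK.
move=> v; apply: (IH i.+1); first by lia.
have h : vanishing (fun N => D k.+2 i N - D k.+1 i.+1 N).
  apply: vanishing_step => [l li|j ji]; last by apply: v1; lia.
  by apply: vanishing_lower v1 _ _ _; lia.
apply: vanishing_near (vanishingD v (vanishingN h)).
by near=> N; rewrite opprB addrC subrK.
Unshelve. all: by end_near. Qed.

Lemma vanishing_power_coefs :
  (forall k, vanishing (fun N => A N k 0%N - B (N - q)%N k 0%N)) <->
  (forall j, vanishing (fun N => A N 1%N j - B (N - q)%N 1%N j)).
Proof.
split=> v; last first.
  by move=> k; apply: (@vanishing_lower k) => [j _|]; [exact: v|rewrite addn0].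
move=> j; have [m] := ubnP j; elim: m j => // m IH j jm.
apply: (@vanishing_top j _ j 0%N); [|exact: addn0|exact: v].
by move=> i ij; apply: IH; lia.
Qed.

End Comparison.

(** * Ratios and Laurent coefficients *)

Section Laurent.
Context {R : realType}.
Variables (M : R) (q : nat) (f g : R[i] -> nat -> R[i]) (a b : nat -> nat -> R[i]).
Hypothesis M0 : 0 <= M.

Definition laurent_tail (f : R[i] -> nat -> R[i]) (a : nat -> nat -> R[i]) :=
  forall z N K, M < cabs z ->
    cabs (f z N - \sum_(k < K) a N k * z ^- k.+1) <= (M / cabs z) ^+ K / (cabs z - M).

Hypotheses (fa : laurent_tail f a) (gb : laurent_tail g b).

Let tail_diff z N K : M < cabs z ->
  cabs (f z N - g z (N - q)%N - \sum_(k < K) (a N k - b (N - q)%N k) * z ^- k.+1)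
  <= 2 * ((M / cabs z) ^+ K / (cabs z - M)).
Proof.
move=> Mz; rewrite mulr2n mulrDl mul1r.
have -> : \sum_(k < K) (a N k - b (N - q)%N k) * z ^- k.+1 =
    \sum_(k < K) a N k * z ^- k.+1 - \sum_(k < K) b (N - q)%N k * z ^- k.+1.
  by rewrite -sumrB; apply: eq_bigr => k _; rewrite mulrBl.
set SA := \sum_(k < K) a N k * _; set SB := \sum_(k < K) b _ k * _.
have -> : f z N - g z (N - q)%N - (SA - SB) = (f z N - SA) - (g z (N - q)%N - SB) by ring.
by rewrite (le_trans (cabsD _ _)) // cabsN lerD ?fa ?gb.
Qed.

(** The tail estimate is uniform in [N], so pointwise limits and limits of
    coefficients can be exchanged; see the introduction. *)
Lemma vanishing_laurent :
  (forall z, M < cabs z -> vanishing (fun N => f z N - g z (N - q)%N)) <->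
  (forall k, vanishing (fun N => a N k - b (N - q)%N k)).
Proof.
split=> v.
  move=> k; have [m] := ubnP k; elim: m k => // m IH k km.
  apply: vanishing_approx => e e0.
  (* This modulus makes the tail after the k-th term, rescaled by [t ^+ k.+1],
     namely [2 * M ^+ k.+1 / (t - M)], at most [e]. *)
  pose t := M + 1 + 2 * M ^+ k.+1 / e.
  have Me : 0 <= 2 * M ^+ k.+1 / e by rewrite divr_ge0 ?(ltW e0) // mulr_ge0 ?exprn_ge0.
  have Mt : M < t by rewrite /t; lra.
  have t0 : 0 < t by exact: le_lt_trans Mt.
  have ct : cabs (real_complex R t) = t by rewrite cabs_real gtr0_norm.
  have ct0 : real_complex R t != 0 by rewrite eq_complex /= eqxx andbT gt_eqF.
  pose z := real_complex R t.
  exists (fun N => z ^+ k.+1 * (f z N - g z (N - q)%N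
      + - \sum_(i < k) z ^- i.+1 * (a N i - b (N - q)%N i))).
    apply: vanishingZ; apply: vanishingD; first by apply: v; rewrite ct.
    apply: vanishingN; apply: vanishing_sum => i; apply: vanishingZ; apply: IH.
    by have := ltn_ord i; lia.
  move=> N; have := @tail_diff z N k.+1; rewrite ct => /(_ Mt).
  set S := \sum_(i < k) _; rewrite big_ord_recr /=.
  have -> : \sum_(i < k) (a N i - b (N - q)%N i) * z ^- i.+1 = S.
    by apply: eq_bigr => i _; rewrite mulrC.
  move=> h; rewrite cabsB_sym.
  have -> : z ^+ k.+1 * (f z N - g z (N - q)%N - S) - (a N k - b (N - q)%N k) =
    z ^+ k.+1 * (f z N - g z (N - q)%N - (S + (a N k - b (N - q)%N k) * z ^- k.+1)).
    by field; rewrite expf_neq0.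
  rewrite cabsM cabsX ct.
  apply: (@le_trans _ _ (t ^+ k.+1 * (2 * ((M / t) ^+ k.+1 / (t - M))))).
    by rewrite ler_wpM2l ?exprn_ge0 ?(ltW t0).
  have -> : t ^+ k.+1 * (2 * ((M / t) ^+ k.+1 / (t - M))) = 2 * M ^+ k.+1 / (t - M).
    rewrite expr_div_n; field.
    by rewrite subr_eq0 !gt_eqF ?exprn_gt0.
  have -> : t - M = (e + 2 * M ^+ k.+1) / e by rewrite /t; field; rewrite gt_eqF.
  have Me0 : 0 <= 2 * M ^+ k.+1 by rewrite mulr_ge0 ?exprn_ge0.
  by rewrite ler_pdivrMr ?divr_gt0 ?ltr_wpDr // [e * _]mulrC divfK ?gt_eqF // lerDr ltW.
move=> z Mz; apply: vanishing_approx => e e0.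
have z0 : 0 < cabs z by exact: le_lt_trans Mz.
have r1 : `|M / cabs z| < 1 by rewrite ger0_norm ?divr_ge0 ?cabs_ge0 // ltr_pdivrMr ?mul1r.
have := cvg_geometric (2 / (cabs z - M)) r1.
move=> /cvgr0Pnorm_le /(_ _ e0)[K _ /(_ K (leqnn K)) /= hK].
exists (fun N => \sum_(k < K) z ^- k.+1 * (a N k - b (N - q)%N k)).
  by apply: vanishing_sum => k; apply: vanishingZ; exact: v.
move=> N; under [X in _ - X]eq_bigr do rewrite mulrC.
apply: le_trans (tail_diff _ _ Mz) _; apply: le_trans hK.
by rewrite (le_trans _ (ler_norm _)) // mulrA mulrAC.
Qed.

End Laurent.

(** * Application to orthonormal polynomials *)

Section Application.
Context {R : realType}.
Variable mu : {finite_measure set (Borel_complex R) -> \bar R}.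
Variables (p : nat -> {poly R[i]}) (M : R).
Hypothesis mu_cpt : compact (supp mu).
Hypothesis M_ge : supp_radius mu <= M.
Hypothesis M_ge0 : 0 <= M.
Hypothesis hp : orthonormal_polys mu p.

Local Notation rho := (real_complex R M).
Local Notation coef := (power_coef (inner_prod mu) p).

Let lin := inner_prod_lin mu_cpt.
Let conj_sym := inner_prod_conj mu_cpt.
Let ge0 := @inner_prod_ge0 R mu.

Let rho_ge0 : 0 <= rho. Proof. by rewrite ler0c. Qed.

Let mulX_le f :
  inner_prod mu ('X * f) ('X * f) <= rho ^+ 2 * inner_prod mu f f.
Proof.
apply: inner_prod_mulX => // z sz.
exact: le_trans (cabs_le_supp_radius mu_cpt sz) M_ge.
Qed.

Lemma power_array_measure : power_array M coef.
Proof.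
have [sz ld on] := hp; split=> [N i|N k i|N k i] iN.
- exact: power_coef0.
- by rewrite -cabs_le rmorphXn; exact: (power_coef_le lin conj_sym ge0).
- exact: (power_coef_rec lin).
Qed.

Lemma laurent_tail_measure :
  laurent_tail M (fun z N => (monic_poly p N).[z] / (monic_poly p N.+1).[z])
    (fun N k => coef N k 0).
Proof.
have [sz ld on] := hp => z N K Mz.
have rz : rho < `|z| by rewrite cabsE ltcR.
have := ratio_expansion lin conj_sym ge0 rho_ge0 mulX_le sz ld on N K rz.
rewrite /monic_poly !hornerZ -cabs_le => /le_trans; apply.
by rewrite cabsE rmorphM rmorphXn fmorphV rmorphM fmorphV rmorphB.
Qed.

Lemma shift_coef_power_coef N j : (j <= N)%N ->
  shift_coef mu p j N.+1 = coef N 1 j.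
Proof.
have [sz ld on] := hp => jN; rewrite /shift_coef /power_coef /bergman_shift /=.
rewrite subn1 /= subSn //= (ip_cshift lin on) ?ltnS ?leq_subr //.
congr (_ * _); rewrite /inner_prod; congr Cintegral; apply/funext => z.
by rewrite hornerM hornerX.
Qed.

End Application.

Theorem theorem1p1 (R : realType)
  (mu nu : {finite_measure set (Borel_complex R) -> \bar R})
  (hmu : compact (supp mu)) (hmu_inf : infinite_set (supp mu))
  (hnu : compact (supp nu)) (hnu_inf : infinite_set (supp nu))
  (p r : nat -> {poly R[i]})
  (hp : orthonormal_polys mu p) (hr : orthonormal_polys nu r)
  (q : nat) :
  (forall z : R[i],
     Num.max (supp_radius mu) (supp_radius nu) < complex.Re `|z| ->
     ((fun n : nat =>
         (monic_poly p (n - 1)).[z] / (monic_poly p n).[z]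
         - (monic_poly r (n - q - 1)).[z] / (monic_poly r (n - q)).[z]) : nat -> R[i]^o)
       @ \oo --> (0 : R[i]^o))
  <->
  (forall j : nat,
     ((fun n : nat => shift_coef mu p j n - shift_coef nu r j (n - q)) : nat -> R[i]^o)
       @ \oo --> (0 : R[i]^o)).
Proof.
set M := Num.max _ _.
have mu_le : supp_radius mu <= M by rewrite le_max lexx.
have nu_le : supp_radius nu <= M by rewrite le_max lexx orbT.
have M0 : 0 <= M.
  apply: le_trans mu_le; apply: supp_radius_ge0 => //.
  by apply/set0P; apply: contra_notN hmu_inf => /eqP ->.
pose f s (z : R[i]) N := (monic_poly s N).[z] / (monic_poly s N.+1).[z].
pose A s (m : {finite_measure set (Borel_complex R) -> \bar R}) := power_coef (inner_prod m) s.
have L : (forall z, M < cabs z -> vanishing (fun N => f p z N - f r z (N - q)%N)) <->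
    (forall k, vanishing (fun N => A p mu N k 0%N - A r nu (N - q)%N k 0%N)).
  exact: (vanishing_laurent q M0 (laurent_tail_measure hmu mu_le M0 hp)
    (laurent_tail_measure hnu nu_le M0 hr)).
have H : (forall k, vanishing (fun N => A p mu N k 0%N - A r nu (N - q)%N k 0%N)) <->
    (forall j, vanishing (fun N => A p mu N 1%N j - A r nu (N - q)%N 1%N j)).
  exact: (vanishing_power_coefs q (power_array_measure hmu mu_le M0 hp)
    (power_array_measure hnu nu_le M0 hr)).
(* The index shift [n = N + 1]; the truncated subtractions agree with the
   intended ones once [N >= q]. *)
have E1 z : vanishing (fun N => f p z N - f r z (N - q)%N) <->
    vanishing (fun n => (monic_poly p (n - 1)).[z] / (monic_poly p n).[z]
         - (monic_poly r (n - q - 1)).[z] / (monic_poly r (n - q)).[z]).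
  rewrite -(vanishing_succ (fun n => _ / (monic_poly p n).[z] - _)).
  by split; apply: vanishing_near; near=> N; rewrite /f subn1 /= subSn ?subn1 //;
    near: N; exact: nbhs_infty_ge.
have E2 j : vanishing (fun N => A p mu N 1%N j - A r nu (N - q)%N 1%N j) <->
    vanishing (fun n => shift_coef mu p j n - shift_coef nu r j (n - q)).
  rewrite -(vanishing_succ (fun n => shift_coef mu p j n - _)).
  split; apply: vanishing_near; near=> N.
    have jN : (q + j <= N)%N by near: N; exact: nbhs_infty_ge.
    by rewrite subSn ?(shift_coef_power_coef hmu hp) ?(shift_coef_power_coef hnu hr) //; lia.
  have jN : (q + j <= N)%N by near: N; exact: nbhs_infty_ge.
  by rewrite subSn ?(shift_coef_power_coef hmu hp) ?(shift_coef_power_coef hnu hr) //; lia.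
split=> [h j|h z Mz].
  apply/vanishingP/E2; apply: (proj1 H); apply: (proj1 L) => z Mz.
  by apply/E1/vanishingP; exact: h.
apply/vanishingP/E1; apply: (proj2 L) => //; apply: (proj2 H) => j.
by apply/E2/vanishingP; exact: h.
Unshelve. all: by end_near. Qed.
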